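(* Let $K$ be a field, $S=K[x_1,\dots,x_n]$, and let $I\subseteq S$ be a left PLP-polymatroidal ideal with data $k$, $d$, $b_1,\dots,b_k$, $\alpha_{k+1},\dots,\alpha_n$, $\beta_{k+1},\dots,\beta_n$. For $A\subseteq\{1,\dots,n\}$ let $P_A=(x_i:i\in A)$. If $P_A\in\operatorname{Ass}(S/I)$, then either $A$ is a subinterval of $[k+2,n]$, or $A=B\cup[k+1,t]$ for some $B\subseteq[1,k]$ and some $t$ with $k+1\le t\le n$.
   Context: For integers $p\le q$, $[p,q]=\{p,p+1,\dots,q\}$; a subinterval is a set of this form. Left PLP-polymatroidal ideal: let $n,k,d$ be positive integers with $1\le k\le n-1$, let $b_1,\dots,b_k$ be positive integers and let $\alpha_i,\beta_i$ $(k+1\le i\le n)$ be non-negative integers with $\alpha_i\le\beta_i$ for all $i$, $\alpha_{k+1}\le\cdots\le\alpha_n=d$ and $\beta_{k+1}\le\cdots\le\beta_n=d$. The corresponding left PLP-polymatroidal ideal $I$ is the monomial ideal of $S$ generated by all $x_1^{u_1}\cdots x_n^{u_n}$, with $u_i$ non-negative integers, such that $0\le u_i\le b_i$ for $1\le i\le k$ and $\alpha_i\le u_1+\cdots+u_i\le\beta_i$ for $i=k+1,\dots,n$. *)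

(* Defs.v *)
From HB Require Import structures.
From mathcomp Require Import all_boot all_order all_algebra.
From mathcomp Require Import mpoly.

Set Implicit Arguments.
Unset Strict Implicit.
Unset Printing Implicit Defensive.

Import GRing.Theory.

Local Open Scope ring_scope.

(* Ideals are [Prop]-valued predicates: the [idealr] structure of
   [ring_quotient] requires a decidable ([bool]-valued) membership test. *)
Section Ideals.
Variable R : comNzRingType.

Definition ideal_gen (G : R -> Prop) (f : R) : Prop :=
  exists s : seq (R * R),
    (forall c, c \in s -> G c.2) /\ f = \sum_(c <- s) c.1 * c.2.

Definition is_ideal (I : R -> Prop) : Prop :=
  [/\ I 0, forall f g, I f -> I g -> I (f + g) & forall f g, I g -> I (f * g)].

Definition is_prime_ideal (P : R -> Prop) : Prop :=
  [/\ is_ideal P, ~ P 1 & forall f g, P (f * g) -> P f \/ P g].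

(* P \in Ass(R/I): P is a prime ideal and P = Ann(f + I) for some class f + I;
   an element g annihilates f + I in R/I iff g * f \in I. *)
Definition is_assoc_prime (I P : R -> Prop) : Prop :=
  is_prime_ideal P /\ exists f : R, forall g : R, P g <-> I (g * f).

End Ideals.

(* Indices are 1-based as in [1, n]: the variable x_j is 'X_i for the ordinal
   i : 'I_n with i.+1 = j. Likewise b, alpha, beta are functions of 1-based
   indices, of which only b_1, ..., b_k and alpha_i, beta_i for k+1 <= i <= n
   are used. *)
Section LeftPLP.
Variables (K : fieldType) (n : nat).

Definition itv (p q : nat) : {set 'I_n} := [set i : 'I_n | p <= i.+1 <= q]%N.

Definition var_ideal (A : {set 'I_n}) : {mpoly K[n]} -> Prop :=
  ideal_gen (fun f => exists2 i : 'I_n, i \in A & f = 'X_i).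

Definition psum (u : 'X_{1..n}) (i : nat) : nat := (\sum_(j in itv 1 i) u j)%N.

Definition left_plp_exponent (k : nat) (b alpha beta : nat -> nat)
    (u : 'X_{1..n}) : Prop :=
  (forall i : 'I_n, i.+1 <= k -> u i <= b i.+1)%N /\
  (forall i : nat, k.+1 <= i <= n -> alpha i <= psum u i <= beta i)%N.

Definition left_plp_ideal (k : nat) (b alpha beta : nat -> nat) :
    {mpoly K[n]} -> Prop :=
  ideal_gen (fun f =>
    exists2 u : 'X_{1..n}, left_plp_exponent k b alpha beta u & f = 'X_[u]).

End LeftPLP.

Arguments itv : clear implicits.
Arguments var_ideal K {n} A _.
Arguments left_plp_ideal : clear implicits.

Definition left_plp_data (n k d : nat) (b alpha beta : nat -> nat) : Prop :=
  [/\ [/\ 0 < n, 0 < d & 1 <= k <= n.-1]%N,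
      (forall i, 1 <= i <= k -> 0 < b i)%N,
      (forall i, k.+1 <= i <= n -> alpha i <= beta i)%N,
      (forall i j, k.+1 <= i -> i <= j -> j <= n ->
         alpha i <= alpha j /\ beta i <= beta j)%N
    & alpha n = d /\ beta n = d].

(* Main.v *)
(* If P_A = Ann(f + I), pick w = d on the complement of A and 0 on A.  As x^w
   is not in P_A, some monomial x^v of f has x^(v+w) outside I, although
   x_a x^(v+w) lies in I for every a in A.  Membership of x^v in I is a
   reachability question for prefix sums, and by a greedy argument it fails
   exactly when some inequality alpha_i <= beta_j + c_(j+1) + ... + c_i is
   violated, where j <= i, c_l = min (v_l, b_l) for l <= k and c_l = v_l
   otherwise.  A violated inequality for v + w must involve every a in A, so A
   is contained in [j+1, i]; and it involves no l > k outside A, where the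
   exponent is at least d, so [j+1, i] minus [1, k] is contained in A. *)
Require Import Defs.
From mathcomp Require Import all_boot all_order all_algebra.
From mathcomp Require Import mpoly.
From mathcomp Require Import zify.

Set Implicit Arguments.
Unset Strict Implicit.
Unset Printing Implicit Defensive.

Import GRing.Theory.

(** Replaces excluded middle for [Prop]-valued properties; it is applied to the support of [f]. *)
Lemma all_or_exists (T : eqType) (P Q : T -> Prop) (s : seq T) :
  (forall x, P x \/ Q x) ->
  (forall x, x \in s -> P x) \/ (exists2 x, x \in s & Q x).
Proof.
move=> PQ; elim: s => [|x s [IH|[y ys Qy]]]; first by left.
  case: (PQ x) => [Px|Qx]; last by right; exists x; rewrite ?mem_head.
  by left=> y; rewrite in_cons => /predU1P [->|/IH].
by right; exists y; rewrite // in_cons ys orbT.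
Qed.

(** * Sequences with bounded terms and bounded increments *)

Section PrefixSums.
Variables alpha beta c : nat -> nat.

(** The greedy maximum: the largest [i]-th term allowed by [beta] and by increments at most [c],
    with [alpha] ignored. *)
Fixpoint max_prefix (i : nat) : nat :=
  if i is i'.+1 then minn (beta i) (max_prefix i' + c i') else beta 0.

(** Take for [j] the last index at which the cap [beta] is active, or 0; from there on only the
    increments count. *)
Lemma max_prefix_attained i :
  exists2 j, j <= i & max_prefix i = beta j + \sum_(j <= l < i) c l.
Proof.
elim: i => [|i [j ji IH]] /=; first by exists 0; rewrite // big_geq ?addn0.
case: leqP => _; first by exists i.+1; rewrite // big_geq ?addn0.
by exists j; [exact: leqW | rewrite IH -addnA big_nat_recr].
Qed.

Lemma max_prefix_le i : max_prefix i <= beta i.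
Proof. by case: i => //= i; rewrite geq_minl. Qed.

(** The sequence is built downwards from [t]. Below [t] comes [minn t (max_prefix n)]: it is within
    [c n] of [t], and it stays above [alpha n] because [alpha] is nondecreasing. *)
Lemma prefix_sums_exist n t :
  (forall i, i < n -> alpha i <= alpha i.+1) ->
  (forall i, i <= n -> alpha i <= max_prefix i) ->
  alpha n <= t <= max_prefix n ->
  exists s : nat -> nat,
    [/\ s n = t, (forall i, i <= n -> alpha i <= s i <= beta i)
      & (forall i, i < n -> s i <= s i.+1 <= s i + c i)].
Proof.
elim: n t => [|n IH] t am aM /andP [at_ tM].
  exists (fun=> t); split=> // i; rewrite leqn0 => /eqP ->.
  by rewrite at_ (leq_trans tM) ?max_prefix_le.
have [|||s [sn sab sc]] := IH (minn t (max_prefix n)).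
- by move=> i /ltnW; exact: am.
- by move=> i /leqW; exact: aM.
- by rewrite geq_minr leq_min aM // (leq_trans (am n _)).
exists (fun i => if i <= n then s i else t); split; first by rewrite ltnn.
  move=> i; rewrite leq_eqVlt => /predU1P [->|]; last first.
    by rewrite ltnS => h; rewrite h sab.
  by rewrite ltnn at_ (leq_trans tM (max_prefix_le _)).
move=> i; rewrite ltnS => lin; rewrite lin.
case: ifP => [|/negbT]; first exact: sc.
rewrite -ltnNge => ni; have {lin ni} -> : i = n by lia.
rewrite sn geq_minl /=; move: tM => /=; lia.
Qed.

Lemma prefix_sums_or_violation n t :
  (forall i, i < n -> alpha i <= alpha i.+1) ->
  alpha n = t -> beta n = t ->
  (exists s : nat -> nat,
    (forall i, i <= n -> alpha i <= s i <= beta i) /\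
    (forall i, i < n -> s i <= s i.+1 <= s i + c i)) \/
  (exists j i, j <= i <= n /\ beta j + \sum_(j <= l < i) c l < alpha i).
Proof.
move=> am an bn.
case: (boolP (all (fun i => alpha i <= max_prefix i) (iota 0 n.+1))).
  move=> /allP H; left.
  have aM i : i <= n -> alpha i <= max_prefix i.
    by move=> hi; apply: H; rewrite mem_iota.
  have [|s [_ h1 h2]] := prefix_sums_exist (t := t) am aM; last by exists s.
  by rewrite -{2}an aM // an leqnn.
move=> /allPn [i]; rewrite mem_iota /= add0n ltnS -ltnNge => hi lti; right.
by have [j ji E] := max_prefix_attained i; exists j, i; rewrite -E ji hi.
Qed.

End PrefixSums.

(** * Membership in monomial ideals *)

Section MonomialIdeals.
Local Open Scope ring_scope.
Variables (K : fieldType) (n : nat).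
Implicit Types (f g : {mpoly K[n]}) (E : 'X_{1..n} -> Prop).

(** Shaped so that [left_plp_ideal] unfolds to the ideal that it generates. *)
Definition monomial_gen E f : Prop := exists2 u, E u & f = 'X_[u].

Lemma ideal_genD (R : comNzRingType) (G : R -> Prop) (x y : R) :
  ideal_gen G x -> ideal_gen G y -> ideal_gen G (x + y).
Proof.
move=> [s [Gs ->]] [t [Gt ->]]; exists (s ++ t); rewrite big_cat; split=> //.
by move=> c; rewrite mem_cat => /orP [/Gs|/Gt].
Qed.

(** A monomial of a sum occurs in some summand [c.1 * 'X_[u]], so [u] divides it; conversely [f] is
    the sum of its terms. *)
Lemma monomial_idealP E f :
  ideal_gen (monomial_gen E) f <->
  (forall m, m \in msupp f -> exists2 u, E u & (u <= m)%MM).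
Proof.
split=> [[s [Gs ->]] m|].
  elim: s Gs => [|c s IH] Gs; first by rewrite big_nil msupp0.
  rewrite big_cons => /msuppD_le; rewrite mem_cat => /orP []; last first.
    by apply: IH => x xs; apply: Gs; rewrite in_cons xs orbT.
  have [u Eu ->] := Gs c (mem_head _ _).
  rewrite (perm_mem (msuppMX _ _)) => /mapP [m' _ ->].
  by exists u; rewrite // lem_addr.
move=> H; rewrite (mpolyE f) big_seq; elim/big_ind: _.
- by exists [::]; rewrite big_nil.
- exact: ideal_genD.
move=> m /H [u Eu um]; exists [:: (f@_m *: 'X_[m - u], 'X_[u])]; split.
  by move=> c; rewrite inE => /eqP ->; exists u.
by rewrite big_seq1 /= -scalerAl -mpolyXD submK.
Qed.

Lemma monomial_ideal_mulX E f w :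
  ideal_gen (monomial_gen E) ('X_[w] * f) <->
  (forall m, m \in msupp f -> exists2 u, E u & (u <= w + m)%MM).
Proof.
split=> [/monomial_idealP H m mf|H].
  by apply: H; rewrite mulrC (perm_mem (msuppMX _ _)) map_f.
apply/monomial_idealP => m; rewrite mulrC (perm_mem (msuppMX _ _)).
by move=> /mapP [m' /H [u Eu um] ->]; exists u.
Qed.

Lemma var_idealX (A : {set 'I_n}) i : i \in A -> var_ideal K A 'X_i.
Proof.
move=> iA; exists [:: (1, 'X_i)]; rewrite big_seq1 mul1r; split=> // c.
by rewrite inE => /eqP ->; exists i.
Qed.

Lemma var_ideal_monomial (A : {set 'I_n}) (w : 'X_{1..n}) :
  var_ideal K A 'X_[w] -> exists2 i, i \in A & (0 < w i)%N.
Proof.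
move=> [s [Gs Es]].
have /monomial_idealP : ideal_gen
    (monomial_gen (fun u => exists2 i, i \in A & u = U_(i)%MM)) 'X_[K, w].
  exists s; split=> // c /Gs [i iA ->]; exists U_(i)%MM => //; by exists i.
move=> /(_ w); rewrite msuppX mem_head => /(_ isT) [_ [i iA ->]] /mnm_lepP.
by move=> /(_ i); rewrite mnmE eqxx => iw; exists i.
Qed.

End MonomialIdeals.

(** * Divisibility by a PLP generator as a system of inequalities *)

Section PLPMembership.
Variables (n k d : nat) (b alpha beta : nat -> nat).
Hypothesis data : left_plp_data n k d b alpha beta.
Implicit Types u v : 'X_{1..n}.

(** Extended by 0 beyond the variables, so that sums can run over intervals of [nat]. *)
Definition mnm_nat u (l : nat) : nat := oapp u 0 (insub l).

Lemma mnm_nat_ord u (i : 'I_n) : mnm_nat u i = u i.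
Proof. by rewrite /mnm_nat valK. Qed.

Lemma psumE u i : i <= n -> psum u i = \sum_(0 <= l < i) mnm_nat u l.
Proof.
move=> le_in; rewrite big_mkord (big_ord_widen _ (mnm_nat u) le_in).
by apply: eq_big => [j|j _]; rewrite ?inE ?mnm_nat_ord.
Qed.

(* The bounds on u_1, ..., u_i for all 0 <= i <= n; those for 1 <= i <= k are
   vacuous, since the total degree is d. *)
Definition lower i := if i <= k then 0 else alpha i.
Definition upper i := if i <= k then (if i == 0 then 0 else d) else beta i.

(* 0-based, like mnm_nat. *)
Definition capacity v l :=
  if l < k then minn (mnm_nat v l) (b l.+1) else mnm_nat v l.

(** The 0-based range [j <= l < i] stands for the variables with 1-based indices in [[j+1, i]]. *)
Definition violated v j i :=
  upper j + \sum_(j <= l < i) capacity v l < lower i.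

Lemma k_lt_n : k < n.
Proof. by case: data => [[n0 _ /andP [_ kn]] _ _ _ _]; lia. Qed.

Lemma lower_le_d i : i <= n -> lower i <= d.
Proof.
move=> le_in; rewrite /lower; case: (leqP i k) => // ki.
by case: data => [_ _ _ /(_ i n ki le_in (leqnn n)) [+ _] [<- _]].
Qed.

Lemma plp_psum u i : left_plp_exponent k b alpha beta u -> i <= n ->
  lower i <= psum u i <= upper i.
Proof.
move=> [_ H] le_in; rewrite /lower /upper; case: (leqP i k) => ki; last first.
  by apply: H; rewrite ki.
case: eqP => [->|_]; first by rewrite psumE // big_geq.
case: data => [_ _ _ _ [_ <-]].
have /H /andP [_] : k < n <= n by rewrite k_lt_n leqnn.
apply: leq_trans; rewrite !psumE //.
by rewrite (@big_cat_nat _ _ _ i 0 n) //= leq_addr.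
Qed.

(** Split [psum u i] at [j]: the first part is at most [upper j], and each later exponent of [u] is
    at most the capacity of [v]. *)
Lemma plp_not_violated u v j i : left_plp_exponent k b alpha beta u ->
  (u <= v)%MM -> j <= i <= n -> ~~ violated v j i.
Proof.
move=> Eu uv /andP [ji le_in]; rewrite /violated -leqNgt.
have /andP [lo _] := plp_psum Eu le_in.
have /andP [_ up] := plp_psum Eu (leq_trans ji le_in).
apply: leq_trans lo _; rewrite psumE // (@big_cat_nat _ _ _ j) //=.
rewrite -psumE ?(leq_trans ji) //; apply: leq_add => //.
rewrite big_nat [leqRHS]big_nat; apply: leq_sum => l /andP [_ li].
have ln := leq_trans li le_in; rewrite /capacity.
rewrite -[l]/(val (Ordinal ln)) !mnm_nat_ord.
case: ifP => lk; last by apply/mnm_lepP.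
by rewrite leq_min (elimT mnm_lepP uv) /= (Eu.1 (Ordinal ln)).
Qed.

Lemma plp_or_violated v :
  (exists2 u, left_plp_exponent k b alpha beta u & (u <= v)%MM) \/
  (exists j i, j <= i <= n /\ violated v j i).
Proof.
have kn := k_lt_n; have [_ _ ab mono [an bn]] := data.
have lo_mono i : i < n -> lower i <= lower i.+1.
  move=> ltin; rewrite /lower; case: (leqP i k) => // ki.
  by rewrite ifF; [exact: (mono i i.+1 ki (leqnSn _) ltin).1 | lia].
have [|||[s [sb sc]]|] := @prefix_sums_or_violation lower upper (capacity v) n d.
- exact: lo_mono.
- by rewrite /lower (leqNgt n k) kn.
- by rewrite /upper (leqNgt n k) kn.
(* The exponents are the increments of [s]. Since [upper 0 = 0] forces [s 0 = 0], their prefix sums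
   telescope to [s]. *)
- left; pose u : 'X_{1..n} := [multinom s i.+1 - s i | i < n].
  have s0 : s 0 = 0 by have := sb 0 isT; rewrite /upper /=; lia.
  have su i : i <= n -> psum u i = s i.
    move=> le_in; rewrite psumE //.
    elim: i le_in => [|i IH] ltin; first by rewrite big_geq.
    rewrite big_nat_recr //= IH ?(ltnW ltin) //.
    rewrite -[X in mnm_nat _ X]/(val (Ordinal ltin)) mnm_nat_ord mnmE /=.
    by have /andP [? _] := sc i ltin; rewrite subnKC.
  have uc (i : 'I_n) : u i <= capacity v i.
    by rewrite mnmE; have /andP [_ h] := sc i (ltn_ord i); rewrite leq_subLR.
  exists u; last first.
    apply/mnm_lepP => i; apply: leq_trans (uc i) _.
    rewrite /capacity -mnm_nat_ord; case: ifP => // _; exact: geq_minl.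
  split=> [i ik|i /andP [ki le_in]].
    by apply: leq_trans (uc i) _; rewrite /capacity ik geq_minr.
  by rewrite su //; have := sb i le_in; rewrite /lower /upper (leqNgt i k) ki.
by move=> ?; right.
Qed.

(** Each excluded case makes the inequality hold: [lower i = 0] if [i <= k], [alpha i <= beta i] if
    [j = i], and [upper j = d] if [0 < j <= k]. *)
Lemma violated_bounds v j i : j <= i <= n -> violated v j i ->
  [/\ k < i, j < i & j = 0 \/ k < j].
Proof.
move=> /andP [ji le_in] vio; have kn := k_lt_n.
have ki : k < i by rewrite ltnNge; apply: contraL vio; rewrite /violated /lower => ->.
split=> //.
  rewrite ltn_neqAle ji andbT; apply: contraL vio => /eqP ->.
  rewrite /violated big_geq // addn0 -leqNgt /lower /upper (leqNgt i k) ki /=.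
  by case: data => [_ _ + _ _]; apply; rewrite ki.
case: (posnP j) => [|j0]; [by left | right].
rewrite ltnNge; apply: contraL vio => jk.
rewrite /violated -leqNgt (leq_trans (lower_le_d le_in)) //.
by rewrite /upper jk eqn0Ngt j0 leq_addr.
Qed.

(** A single capacity of [d] already reaches [lower i], which is at most [d]. *)
Lemma violated_capacity v j i l : j <= i <= n -> violated v j i ->
  j <= l < i -> capacity v l < d.
Proof.
move=> /andP [ji le_in] vio li; rewrite ltnNge; apply: contraL vio => dl.
rewrite /violated -leqNgt (leq_trans (lower_le_d le_in)) //.
rewrite (leq_trans dl) //; apply: leq_trans (leq_addl _ _).
by rewrite (bigD1_seq l) ?iota_uniq ?mem_index_iota //= leq_addr.
Qed.

Lemma violated_add v (a : 'I_n) j i : violated v j i -> ~~ (j <= a < i) ->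
  violated (U_(a) + v)%MM j i.
Proof.
move=> vio aji; apply: leq_trans vio; rewrite ltnS leq_add2l.
rewrite big_nat [leqRHS]big_nat; apply: leq_sum => l lji.
suff -> : capacity (U_(a) + v)%MM l = capacity v l by [].
suff E : mnm_nat (U_(a) + v)%MM l = mnm_nat v l by rewrite /capacity E.
rewrite /mnm_nat; case: insubP => //= x _ xl; rewrite mnmDE mnm1E.
by case: eqP => // ax; move: aji; rewrite ax xl lji.
Qed.

End PLPMembership.

(** * From a violated inequality to the shape of [A] *)

Theorem corollary5p5 (K : fieldType) (n k d : nat) (b alpha beta : nat -> nat)
    (data : left_plp_data n k d b alpha beta) (A : {set 'I_n}) :
  is_assoc_prime (left_plp_ideal K n k b alpha beta) (var_ideal K A) ->
  (exists p q : nat, (k.+2 <= p)%N /\ (p <= q)%N /\ (q <= n)%N /\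
     A = itv n p q) \/
  (exists (B : {set 'I_n}) (t : nat),
     B \subset itv n 1 k /\ (k.+1 <= t <= n)%N /\ A = B :|: itv n k.+1 t).
Proof.
move=> [_ [f annf]].
pose w : 'X_{1..n} := [multinom (if i \in A then 0 else d) | i < n].
have [Hw|[v vf [j [i [jin vio]]]]] := all_or_exists (msupp f)
    (fun v => plp_or_violated data (w + v)%MM).
  (* Here ['X_[w] * f] lies in the ideal, so ['X_[w]] lies in [P_A], although [w] vanishes on
     [A]. *)
  have /annf /var_ideal_monomial [a aA] :
    left_plp_ideal K n k b alpha beta ('X_[w] * f)%R.
    exact/monomial_ideal_mulX.
  by rewrite mnmE aA.
have [ki ji j0k] := violated_bounds data jin vio.
(* Multiplication by ['X_a] repairs every violation, which is impossible when [a] is outside the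
   range of the sum. *)
have A_sub (a : 'I_n) : a \in A -> j <= a < i.
  move=> aA; apply/negPn/negP => aji.
  have /annf /monomial_ideal_mulX /(_ v vf) [u Eu ule] := var_idealX K aA.
  have : ~~ violated k d b alpha beta (U_(a) + (w + v))%MM j i.
    apply: (plp_not_violated data Eu) => //.
    by apply: lepm_trans ule _; rewrite addmA (addmC _ w) -addmA lem_addl.
  by rewrite (violated_add vio aji).
(* Outside [A] the exponent is at least [d], and beyond the first [k] variables no [b] truncates
   it. *)
have A_sup (a : 'I_n) : k <= a -> j <= a < i -> a \in A.
  move=> ka aji; have := violated_capacity data jin vio aji.
  rewrite /capacity (ltnNge a k) ka /= mnm_nat_ord mnmDE mnmE.
  by case: (a \in A) => //; rewrite ltnNge leq_addr.
case/andP: jin => _ le_in; case: j0k => [j0|kj]; [right | left].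
  (* With [j = 0], [A] contains every index of [[k+1, i]] and none above [i]; its part in [[1, k]]
     is arbitrary. *)
  exists (A :&: itv n 1 k), i; rewrite subsetIr ki le_in; do 2!split=> //.
  apply/setP => a; rewrite !inE /=; case: (ltnP a k) => ak.
    by rewrite ltnS leqNgt ak andbT orbF.
  rewrite andbF ltnS ak /=; apply/idP/idP => [/A_sub /andP [] //|ai].
  by apply: A_sup; rewrite // j0.
(* With [k < j] the whole range lies beyond [k], so [A] is exactly [[j+1, i]], and [j+1 >= k+2]. *)
exists j.+1, i; do 3!split=> //; apply/setP => a; rewrite !inE /=.
apply/idP/idP => [/A_sub //|aji]; apply: A_sup => //.
by apply: leq_trans (ltnW kj) _; case/andP: aji.
Qed.
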